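(* Let $X$ be a non-empty finite set and let $V^1,\dots,V^n:\Delta(X)\to\mathbb{R}$ be continuous functions. For every $\mu\in\Delta(X)$, the set $$\mathcal{V}(\mu)=\left\{\left(E_P[V^1],\dots,E_P[V^n]\right)\ :\ P\in\Delta^2(X),\ E_P[\nu]=\mu\right\}\subset\mathbb{R}^n$$ is compact and convex. Moreover, for every integer $0\le k\le n$ and every $k$-extreme point $v\in\mathrm{ext}_k(\mathcal{V}(\mu))$ there exists $P\in\Delta^2(X)$ with $E_P[\nu]=\mu$ such that $v=\left(E_P[V^1],\dots,E_P[V^n]\right)$ and $|\mathrm{supp}(P)|\le (k+1)|X|$.
   Context: $\Delta(X)\subset\mathbb{R}^{|X|}$ is the simplex of probability measures on the finite set $X$, and $\Delta^2(X)$ is the set of all Borel probability measures on $\Delta(X)$. For $P\in\Delta^2(X)$, $E_P[\nu]=\int_{\Delta(X)}\nu\,dP(\nu)$ is the barycenter and $E_P[V]=\int_{\Delta(X)}V(\nu)\,dP(\nu)$; $\mathrm{supp}(P)$ is the support of $P$. For a convex set $C\subset\mathbb{R}^n$, $\mathrm{ext}_k(C)$ denotes the set of $k$-extreme points of $C$: the points of $C$ lying in the relative interior of a $k$-dimensional face of $C$ (so every point of $C$ belongs to $\mathrm{ext}_k(C)$ for some $k\le n$). *)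

(* Defs.v *)
From HB Require Import structures.
From mathcomp Require Import all_boot all_order all_algebra.
From mathcomp Require Import all_classical all_reals all_analysis.

Set Implicit Arguments.
Unset Strict Implicit.
Unset Printing Implicit Defensive.

Import Order.TTheory GRing.Theory Num.Theory.
Import numFieldNormedType.Exports.

Local Open Scope classical_set_scope.
Local Open Scope ring_scope.

(* Non-empty finite sets.  The distinguished point is only needed because a
   [measurableType] is pointed; it is used to build the point of [simplex]. *)
#[short(type="finPointedType")]
HB.structure Definition FinPointed := {X of Finite X & Pointed X}.

Section Simplex.
Context (R : realType) (X : finPointedType).

(* Coordinates are indexed through the enumeration of [X]: the weight of
   [x : X] is [nu 0 (enum_rank x)]. *)
Definition simplex_set : set 'rV[R]_#|X| :=
  [set nu | (forall i, 0 <= nu 0 i) /\ \sum_i nu 0 i = 1].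

Definition simplex : Type := set_type simplex_set.

HB.instance Definition _ := PseudoMetric.copy simplex (set_type simplex_set).

Lemma simplex_vertex (x : X) : delta_mx 0 (enum_rank x) \in simplex_set.
Proof.
apply/mem_set; split=> [i|]; first by rewrite mxE ler0n.
rewrite (bigD1 (enum_rank x))//= big1 ?addr0 ?mxE ?eqxx// => i ix.
by rewrite mxE (negbTE ix) andbF.
Qed.

HB.instance Definition _ := isPointed.Build simplex
  (exist _ (delta_mx 0 (enum_rank point)) (simplex_vertex point)).

Definition simplex_borel := g_sigma_algebraType (@open simplex).

Definition Delta2 := probability simplex_borel R.

Definition barycenter (P : Delta2) : 'rV[R]_#|X| :=
  \row_i \int[P]_nu (val nu 0 i).

Definition measure_support (P : Delta2) : set simplex :=
  [set nu | forall U : set simplex, open_nbhs nu U -> (0 < P U)%E].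

Definition expected_values (n : nat) (V : 'I_n -> simplex -> R) (P : Delta2) :
  'rV[R]_n := \row_i \int[P]_nu V i nu.

Definition value_set (n : nat) (V : 'I_n -> simplex -> R) (mu : simplex) :
  set 'rV[R]_n :=
  [set expected_values V P | P in [set P | barycenter P = val mu]].

End Simplex.

Section ExtremePoints.
Context (R : realType) (n : nat).
Implicit Types (C F : set 'rV[R]_n) (k : nat).

Definition affine_hull F : set 'rV[R]_n :=
  [set v | exists m (w : 'I_m -> R) (u : 'I_m -> 'rV[R]_n),
    [/\ forall i, F (u i), \sum_i w i = 1 & v = \sum_i w i *: u i]].

(* No [k] satisfies this when [F] is empty. *)
Definition has_affine_dim F k : Prop :=
  exists (x : 'rV[R]_n) (U : {vspace 'rV[R]_n}),
    \dim U = k /\ affine_hull F = [set x + u | u in [set` U]].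

Definition relative_interior F : set 'rV[R]_n :=
  [set x | F x /\ \forall y \near x, affine_hull F y -> F y].

Definition is_face C F : Prop :=
  [/\ F `<=` C, convex_set F &
      forall x y (t : R), C x -> C y -> 0 < t < 1 ->
        F (t *: x + (1 - t) *: y) -> F x /\ F y].

Definition extreme_points k C : set 'rV[R]_n :=
  [set v | exists F, [/\ is_face C F, has_affine_dim F k &
                         relative_interior F v]].

End ExtremePoints.

(* Main.v *)
Require Import Defs.
From HB Require Import structures.
From mathcomp Require Import all_boot all_order all_algebra.
From mathcomp Require Import all_classical all_reals all_analysis.
From mathcomp Require Import measurable_realfun.
From mathcomp Require Import ring lra zify.

Import Order.TTheory GRing.Theory Num.Theory.
Import numFieldNormedType.Exports.

Local Open Scope classical_set_scope.
Local Open Scope ring_scope.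

(** Write [m] for the number of points of [X] and let [graph V] send a measure
[nu] to the pair [(nu, V nu)], a vector with [m + n] coordinates.  Everything
follows from the description of the value set as a slice of a convex hull
([value_setP]): [v] is a value at [mu] iff [(mu, v)] is a finite convex
combination of points of the graph.  One direction puts a finitely supported
probability on the points of the combination ([finite_support_realization]).
The other one says that the expectation of [graph V] lies in the convex hull
of its range.  This hull is compact, because by Caratheodory's theorem
([caratheodory]) combinations of a bounded number of points fill it
([compact_mixtures]); and a random vector with values in a compact convex set
has its expectation there: otherwise the direction from the nearest point of
the set to the expectation would be a linear functional whose average exceeds
its maximum ([expectation_in_compact_convex]).  The slice of a compact convex
set by an affine subspace is compact and convex, which gives the first two
claims.

For the bound on the support, let [v] lie in a face [F] of dimension [k].
By the conic version of Caratheodory's theorem ([conic_caratheodory]),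
[(mu, v)] is a combination, with positive weights [w], of [N] linearly
independent points [(nu_i, V nu_i)].  Consider the coefficient vectors [c]
with [\sum_i c_i nu_i = 0]; they form a space of dimension at least [N - m].
For a small real [s] the weights [w + s c] are still nonnegative, and
represent [(mu, v + s d)] where [d = \sum_i c_i V nu_i].  Thus [v] is the
midpoint of two points of the value set on the line of direction [d], so [d]
is a direction of the face [F] ([face_direction]).  By linear independence
the map from [c] to [d] is injective, hence [N - m <= k], and
[N <= m + k <= (k + 1) m]. *)

Set Implicit Arguments.
Unset Strict Implicit.
Unset Printing Implicit Defensive.

(** * Convex combinations and Caratheodory's theorem *)

(** A combination of the values of [G] at finitely many sample points is a row
of weights times this matrix, so that linear independence of the values is
[row_free]. *)
Definition sample_mx {R : realType} {T : Type} {d N : nat} (G : T -> 'rV[R]_d)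
    (x : 'I_N -> T) : 'M[R]_(N, d) :=
  \matrix_i G (x i).

Lemma mul_sample_mx (R : realType) (T : Type) (d N : nat) (G : T -> 'rV[R]_d)
    (x : 'I_N -> T) (w : 'rV[R]_N) :
  w *m sample_mx G x = \sum_i w 0 i *: G (x i).
Proof. by rewrite mulmx_sum_row; apply: eq_bigr => i _; rewrite rowK. Qed.

Lemma mul_sample_mx_drop (R : realType) (T : Type) (d N : nat)
    (G : T -> 'rV[R]_d) (x : 'I_N.+1 -> T) (w : 'rV[R]_N.+1) (i : 'I_N.+1) :
  w 0 i = 0 ->
  col' i w *m sample_mx G (x \o lift i) = w *m sample_mx G x.
Proof.
move=> wi0; rewrite !mul_sample_mx (bigD1_ord i)//= wi0 scale0r add0r.
by apply: eq_bigr => j _; rewrite mxE.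
Qed.

Lemma sample_row_mx (R : realType) (T : Type) (a b N : nat)
    (F : T -> 'rV[R]_a) (G : T -> 'rV[R]_b) (x : 'I_N -> T) :
  sample_mx (fun t => row_mx (F t) (G t)) x =
  row_mx (sample_mx F x) (sample_mx G x).
Proof.
apply/matrixP => i j; rewrite !mxE.
by case: splitP => k _; rewrite mxE.
Qed.

(** A linear dependency [c] between the points with [c_i > 0] for some [i] can
be subtracted from the weights until the first of them vanishes; the others
stay nonnegative and the corresponding point can be dropped. *)
Lemma conic_caratheodory (R : realType) (T : Type) (d : nat)
    (G : T -> 'rV[R]_d) (N : nat) (x : 'I_N -> T) (w : 'rV[R]_N) :
  (forall i, 0 <= w 0 i) ->
  exists M (y : 'I_M -> T) (u : 'rV[R]_M),
    [/\ forall i, 0 < u 0 i, row_free (sample_mx G y) &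
        u *m sample_mx G y = w *m sample_mx G x].
Proof.
elim: N => [|N IH] in x w * => w0.
  exists 0%N, x, w; split=> [[]//||//].
  by rewrite /row_free -leqn0 rank_leq_row.
have drop (v : 'rV[R]_N.+1) (i : 'I_N.+1) :
    (forall j, 0 <= v 0 j) -> v 0 i = 0 ->
    v *m sample_mx G x = w *m sample_mx G x ->
    exists M (y : 'I_M -> T) (u : 'rV[R]_M),
      [/\ forall i, 0 < u 0 i, row_free (sample_mx G y) &
          u *m sample_mx G y = w *m sample_mx G x].
  move=> v0 vi0 <-; rewrite -(mul_sample_mx_drop G x vi0).
  by apply: IH => j; rewrite mxE.
have [|/negP] := boolP [exists i, w 0 i == 0].
  by case/existsP=> i /eqP wi0; exact: drop w0 wi0 _.
move=> wn0; have {wn0}wp i : 0 < w 0 i.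
  rewrite lt_def w0 andbT; apply: contra_notN wn0 => wi0.
  by apply/existsP; exists i.
have [free|] := boolP (row_free (sample_mx G x)).
  by exists N.+1, x, w.
rewrite -kermx_eq0 => /rowV0Pn[c /sub_kermxP cA c0].
have {c c0 cA} [c [cA [i0 ci0]]] :
    exists c' : 'rV_N.+1, c' *m sample_mx G x = 0 /\ exists i, 0 < c' 0 i.
  have /rV0Pn[i] := c0; case: ltgtP => // ci _; last first.
    by exists c; split=> //; exists i.
  exists (- c); rewrite mulNmx cA oppr0; split=> //.
  by exists i; rewrite mxE oppr_gt0.
(* the index whose weight vanishes first along [- c] *)
have [i ci imin] := @arg_minP _ _ _ i0
  (fun i => 0 < c 0 i) (fun i => w 0 i / c 0 i) ci0.
pose t := w 0 i / c 0 i.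
apply: (drop (w - t *: c) i).
- move=> j; rewrite !mxE subr_ge0.
  have [cj|cj] := ltP 0 (c 0 j); first by rewrite -ler_pdivlMr//; exact: imin.
  apply: le_trans (w0 j); rewrite mulr_ge0_le0// divr_ge0// ltW//.
- by rewrite !mxE /t divfK ?subrr// gt_eqF.
- by rewrite mulmxBl -scalemxAl cA scaler0 subr0.
Qed.

(** The convex hull of the range of [G]. *)
Definition mixtures {R : realType} {T : Type} {d : nat} (G : T -> 'rV[R]_d) :
    set 'rV[R]_d :=
  [set z | exists N (x : 'I_N -> T) (w : 'rV[R]_N),
    [/\ forall i, 0 <= w 0 i, \sum_i w 0 i = 1 & z = w *m sample_mx G x]].

Lemma mixtures_range (R : realType) (T : Type) (d : nat)
  (G : T -> 'rV[R]_d) (t : T) : mixtures G (G t).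
Proof.
exists 1%N, (fun=> t), 1; split=> [i||]; rewrite ?big_ord1 ?mxE ?eqxx ?ord1//.
by rewrite mul_sample_mx big_ord1 mxE eqxx scale1r.
Qed.

Lemma convex_mixtures (R : realType) (T : Type) (d : nat)
  (G : T -> 'rV[R]_d) : convex_set (mixtures G).
Proof.
move=> _ _ p /set_mem[M [x [u [u0 u1 ->]]]] /set_mem[N [y [w [w0 w1 ->]]]].
apply/mem_set; exists (M + N)%N.
exists (fun i => match fintype.split i with inl j => x j | inr k => y k end).
exists (row_mx (p%:num *: u) ((1 - p%:num) *: w)); split.
- move=> i; rewrite -[i]splitK; case: (fintype.split i) => j /=.
    by rewrite row_mxEl mxE mulr_ge0.
  by rewrite row_mxEr mxE mulr_ge0// subr_ge0.
- rewrite big_split_ord/=.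
  under eq_bigr do rewrite row_mxEl mxE.
  under [X in _ + X]eq_bigr do rewrite row_mxEr mxE.
  by rewrite -!mulr_sumr u1 w1 !mulr1 subrKC.
- rewrite !mul_sample_mx big_split_ord/=; congr (_ + _);
    rewrite scaler_sumr; apply: eq_bigr => i _.
    by rewrite row_mxEl mxE scalerA (unsplitK (inl i)).
  by rewrite row_mxEr mxE scalerA (unsplitK (inr i)).
Qed.

(** The affine version reduces to the conic one by adjoining a coordinate
constantly equal to 1, which records the total weight. *)
Lemma caratheodory (R : realType) (T : Type) (d : nat)
    (G : T -> 'rV[R]_d) (z : 'rV[R]_d) :
  mixtures G z -> exists N (x : 'I_N -> T) (w : 'rV[R]_N),
    [/\ (N <= d.+1)%N, forall i, 0 <= w 0 i, \sum_i w 0 i = 1 &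
        z = w *m sample_mx G x].
Proof.
move=> [N [x [w [w0 w1 ->]]]].
have [M [y [u [u0 free]]]] :=
  conic_caratheodory (fun t => row_mx (1 : 'rV_1) (G t)) x w0.
have ones K (v : 'rV[R]_K) (s : 'I_K -> T) :
    v *m sample_mx (fun=> 1 : 'rV[R]_1) s = (\sum_i v 0 i)%:M.
  rewrite mul_sample_mx; apply/rowP => i.
  rewrite summxE !mxE !ord1 eqxx; apply: eq_bigr => j _.
  by rewrite !mxE eqxx mulr1.
rewrite !sample_row_mx !mul_mx_row !ones => /eq_row_mx[u1 uG].
exists M, y, u; split=> //.
- by rewrite -(eqP free); exact: rank_leq_col.
- by move=> i; exact: ltW.
- by rewrite -w1; move/rowP: u1 => /(_ 0); rewrite !mxE.
Qed.

(** * Compactness *)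

Lemma continuous_mx (K : numFieldType) (T : topologicalType) (m n : nat)
    (f : T -> 'M[K]_(m, n)) :
  (forall i j, continuous (fun t => f t i j)) -> continuous f.
Proof.
move=> cf t A [P tP PA].
have : \forall s \near t, forall i j, P i j (f s i j).
  by apply: filter_forall => i; apply: filter_forall => j; exact: cf (tP i j).
by apply: filterS => s Ps; exact: PA.
Qed.

Lemma continuous_sum (K : numFieldType) (V : normedModType K)
    (T : topologicalType) (I : Type) (r : seq I) (f : I -> T -> V) :
  (forall i, continuous (f i)) -> continuous (fun t => \sum_(i <- r) f i t).
Proof.
move=> cf; elim: r => [|i r IH] t.
  by under eq_fun do rewrite big_nil; exact: cvg_cst.
by under eq_fun do rewrite big_cons; apply: cvgD; [exact: cf|exact: IH].
Qed.

Lemma compact_set_type (T : topologicalType) (A : set T) :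
  compact A -> compact [set: set_type A].
Proof.
move=> cA F FF _.
have /cA[p [Ap clp]] : (set_val @ F) A.
  by apply: (@filterS _ F _ setT) filterT => -[a Aa] _; exact: set_mem Aa.
exists (exist _ p (mem_set Ap)); split=> // B C FB [_ [[D oD <-] /= Dp] DC].
have [||q [[b Bb <-] Db]] := clp (set_val @` B) D.
- by apply: (@filterS _ F _ B) FB => b Bb; exists b.
- by apply: open_nbhs_nbhs; split=> //; exact: Dp.
- by exists b; split=> //; exact: DC.
Qed.

Lemma compact_simplex (R : realType) (X : finPointedType) :
  compact [set: simplex R X].
Proof.
apply: compact_set_type; apply: bounded_closed_compact.
  exists 1; split; first by rewrite num_real.
  move=> M M1 nu [nu0 nu1] /=.
  rewrite [leLHS]mx_normrE; apply/bigmax_leP; split.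
    by rewrite (le_trans _ (ltW M1)).
  move=> [i j] _ /=; rewrite ord1 ger0_norm// (le_trans _ (ltW M1))//.
  by rewrite -nu1 (bigD1 j)//= lerDl sumr_ge0.
rewrite (_ : @simplex_set R X =
  (\bigcap_(i in setT) [set nu : 'rV[R]_#|X| | 0 <= nu 0 i]) `&`
  [set nu : 'rV[R]_#|X| | \sum_i nu 0 i = 1]); last first.
  apply/seteqP; split=> nu /= [nu0 nu1]; split=> // i.
    by move=> _; exact: nu0.
  exact: (nu0 i I).
apply: closedI.
  apply: closed_bigI => i _.
  apply: (preimage_closed _ (@closed_ge _ 0)) => nu _; exact: coord_continuous.
apply: (preimage_closed _ (@closed_eq _ 1)) => nu _.
by apply: continuous_sum => i; exact: coord_continuous.
Qed.

Lemma continuous_simplex_val (R : realType) (X : finPointedType) :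
  continuous (val : simplex R X -> 'rV[R]_#|X|).
Proof. exact: initial_continuous. Qed.

(** By Caratheodory's theorem the hull is a finite union, over the number of
points, of images of compact sets of weighted families of points. *)
Lemma compact_mixtures (R : realType) (T : topologicalType) (d : nat)
    (G : T -> 'rV[R]_d) :
  compact [set: T] -> continuous G -> compact (mixtures G).
Proof.
move=> cT cG.
pose simplices N : set (prod_topology (fun _ : 'I_N => (R * T)%type)) :=
  [set f | forall i, (`[0, 1] `*` setT) (f i)] `&` [set f | \sum_i (f i).1 = 1].
pose mix N (f : prod_topology (fun _ : 'I_N => (R * T)%type)) : 'rV[R]_d :=
  \sum_i (f i).1 *: G (f i).2.
have c1 N (i : 'I_N) : continuous
    (fun f : prod_topology (fun _ : 'I_N => (R * T)%type) => (f i).1 : R).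
  move=> f; apply: continuous_comp; first exact: proj_continuous.
  exact: cvg_fst.
have c2 N (i : 'I_N) : continuous
    (fun f : prod_topology (fun _ : 'I_N => (R * T)%type) => G (f i).2).
  move=> f; apply: continuous_comp; last exact: cG.
  apply: continuous_comp; first exact: proj_continuous.
  exact: cvg_snd.
have -> : mixtures G =
    \big[setU/set0]_(N < d.+2) (mix N @` simplices N).
  apply/seteqP; split=> z.
    move=> /caratheodory[N [x [w [Nd w0 w1 ->]]]].
    rewrite -(bigcup_mkord _ (fun N => mix N @` simplices N)).
    exists N => //=; exists (fun i => (w 0 i, x i)); last first.
      by rewrite mul_sample_mx.
    split=> // i; split=> //=; rewrite in_itv/= w0/=.
    by rewrite -w1 (bigD1 i)//= lerDl sumr_ge0.
  rewrite -(bigcup_mkord _ (fun N => mix N @` simplices N)).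
  move=> [N _ [f [/= f01 f1] <-]].
  exists N, (fun i => (f i).2), (\row_i (f i).1); split.
  - by move=> i; rewrite mxE; have [] := f01 i; rewrite /= in_itv/= => /andP[].
  - by rewrite -f1; apply: eq_bigr => i _; rewrite mxE.
  - by rewrite mul_sample_mx; apply: eq_bigr => i _; rewrite mxE.
apply: bigsetU_compact => N _; apply: continuous_compact.
  apply: continuous_subspaceT; apply: continuous_sum => i f.
  exact: cvgZ (c1 N i f) (c2 N i f).
apply: compact_closedI.
  apply: (@tychonoff _ (fun _ : 'I_N => (R * T)%type)
    (fun=> `[0, 1] `*` setT)) => i.
  by apply: compact_setX => //; exact: segment_compact.
apply: (preimage_closed _ (@closed_eq _ 1)) => f _.
by apply: continuous_sum => i; exact: c1.
Qed.

(** * Finitely supported probabilities *)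

Section Atomic.
Context (d : measure_display) (T : measurableType d) (R : realType).
Context (N : nat) (w : 'I_N -> {nonneg R}) (x : 'I_N -> T).
Implicit Type wT : \sum_i (w i)%:num = 1.

(** The default values are never reached: only the measures of index less than
[N] enter the sum. *)
Definition atoms (k : nat) : {measure set T -> \bar R} :=
  mscale (oapp w 0%:nng (insub k)) \d_(oapp x point (insub k)).

(** The proof that the weights sum to 1 is an argument so that the probability
structure can be inferred from the term. *)
Definition atomic of \sum_i (w i)%:num = 1 : set T -> \bar R := msum atoms N.

HB.instance Definition _ wT := Measure.on (atomic wT).

Lemma atomicE wT (A : set T) :
  atomic wT A = (\sum_i (w i)%:num%:E * \d_(x i) A)%E.
Proof. by apply: eq_bigr => i _; rewrite /atoms valK. Qed.

Lemma atomic_setT wT : atomic wT setT = 1%E.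
Proof.
rewrite atomicE; under eq_bigr do rewrite diracT mule1.
by rewrite sumEFin wT.
Qed.

HB.instance Definition _ wT :=
  @Measure_isProbability.Build _ _ R (atomic wT) (atomic_setT wT).

Lemma integral_atomic_ge0 wT (f : T -> \bar R) : measurable_fun setT f ->
  (forall t, 0 <= f t)%E ->
  (\int[atomic wT]_t f t = \sum_i (w i)%:num%:E * f (x i))%E.
Proof.
move=> mf f0; rewrite ge0_integral_measure_sum//.
apply: eq_bigr => i _; rewrite /atoms valK/=.
by rewrite ge0_integral_mscale// integral_dirac// diracT mul1e.
Qed.

(** Integrals of nonnegative functions are additive in the measure; the
general case follows from the positive and negative parts. *)
Lemma Rintegral_atomic wT (f : T -> R) : measurable_fun setT f ->
  \int[atomic wT]_t f t = \sum_i (w i)%:num * f (x i).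
Proof.
move=> /measurable_EFinP mf; rewrite /Rintegral integralE.
rewrite integral_atomic_ge0//; last exact: measurable_funepos.
rewrite integral_atomic_ge0//; last exact: measurable_funeneg.
under eq_bigr do rewrite funeposE -EFin_max -EFinM.
under [X in (_ - X)%E]eq_bigr do rewrite funenegE -EFinN -EFin_max -EFinM.
rewrite !sumEFin -EFinB/= -sumrB; apply: eq_bigr => i _.
rewrite -mulrBr; congr (_ * _); rewrite /Num.max; do 2 case: ifP; lra.
Qed.

End Atomic.

(** * The expectation belongs to the convex hull *)

Lemma Rintegral_sum (d : measure_display) (T : measurableType d)
    (R : realType) (mu : {measure set T -> \bar R}) (I : Type) (r : seq I)
    (f : I -> T -> R) :
  (forall i, mu.-integrable setT (EFin \o f i)) ->
  \int[mu]_t (\sum_(i <- r) f i t) = \sum_(i <- r) \int[mu]_t f i t.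
Proof.
move=> intf; elim: r => [|i r IH].
  rewrite big_nil; under eq_Rintegral do rewrite big_nil.
  by rewrite /Rintegral integral0.
rewrite big_cons -IH -RintegralD//; last first.
  apply: (eq_integrable measurableT (fun t => \sum_(i <- r) (f i t)%:E)%E).
    by move=> t _; rewrite /= sumEFin.
  by apply: integrable_sum => // j _; exact: intf.
by apply: eq_Rintegral => t _; rewrite big_cons.
Qed.

(** Moving from the nearest point [z0] towards [h] by a small step [t] changes
the squared distance to [z] by [- 2 t a + t ^ 2 b], where [a] is the scalar
product to be bounded; this would be negative if [a > 0]. *)
Lemma nearest_point_le0 (R : realType) (d : nat) (C : set 'rV[R]_d)
    (z z0 h : 'rV[R]_d) :
  convex_set C -> C z0 -> C h ->
  (forall c, C c ->
    \sum_j (z 0 j - z0 0 j) ^+ 2 <= \sum_j (z 0 j - c 0 j) ^+ 2) ->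
  \sum_j (z 0 j - z0 0 j) * (h 0 j - z0 0 j) <= 0.
Proof.
move=> convC Cz0 Ch zmin; rewrite leNgt; apply/negP => a0.
set a := (X in 0 < X) in a0.
pose b := \sum_j (h 0 j - z0 0 j) ^+ 2.
have b0 : 0 <= b by apply: sumr_ge0 => j _; exact: sqr_ge0.
(* any positive step smaller than both [1] and [2 a / b] would do *)
pose t := a / (a + b).
have t0 : 0 < t by rewrite divr_gt0// ltr_wpDr.
have t1 : t <= 1 by rewrite ler_pdivrMr ?mul1r ?lerDl// ltr_wpDr.
have := convC h z0 (Itv01 (ltW t0) t1) (mem_set Ch) (mem_set Cz0).
move=> /set_mem/zmin; apply/negP; rewrite -ltNge.
rewrite [ltLHS](_ : _ =
  \sum_j (z 0 j - z0 0 j) ^+ 2 - 2 * t * a + t ^+ 2 * b); last first.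
  rewrite !mulr_sumr -sumrB -big_split/=; apply: eq_bigr => j _.
  by rewrite !mxE/= /unstable.onem; ring.
have : t * (a + b) = a by rewrite divfK// gt_eqF// ltr_wpDr.
nra.
Qed.

(** Let [z0] be the point of [C] nearest to the expectation [z].  Integrating
[nearest_point_le0] along [G] bounds the squared distance from [z] to [z0]
by 0. *)
Lemma expectation_in_compact_convex (d : measure_display)
    (T : measurableType d) (R : realType) (P : probability T R) (n : nat)
    (G : T -> 'rV[R]_n) (C : set 'rV[R]_n) :
  (forall j, P.-integrable setT (EFin \o (fun t => G t 0 j))) ->
  compact C -> convex_set C -> range G `<=` C ->
  C (\row_j \int[P]_t G t 0 j).
Proof.
move=> intG cC convC GC; set z := \row_j _.
have C0 : C !=set0 by exists (G point); apply: GC; exists point.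
pose f (c : 'rV[R]_n) := \sum_j (z 0 j - c 0 j) ^+ 2.
have cf : continuous f.
  apply: continuous_sum => j c.
  have cj : z 0 j - c' 0 j @[c' --> c] --> z 0 j - c 0 j.
    by apply: cvgB; [exact: cvg_cst|exact: coord_continuous].
  exact: (cvgM cj cj).
have [z0 /set_mem Cz0 zmin] :=
  compact_EVT_min C0 cC (continuous_subspaceT cf).
suff -> : z = z0 by [].
have Ecst r : \int[P]_t r = r.
  rewrite Rintegral_cst// (_ : fine _ = 1) ?mulr1//.
  exact: (congr1 fine (probability_setT P)).
have intcst r : P.-integrable setT (EFin \o cst r).
  exact: finite_measure_integrable_cst.
have intB j : P.-integrable setT (EFin \o (fun t => G t 0 j - z0 0 j)).
  exact: (integrableB measurableT (intG j) (intcst _)).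
have intM j : P.-integrable setT
    (EFin \o (fun t => (z 0 j - z0 0 j) * (G t 0 j - z0 0 j))).
  exact: (integrableZl measurableT _ (intB j)).
have fz0 : f z0 <= 0.
  rewrite /f.
  have -> : \sum_j (z 0 j - z0 0 j) ^+ 2 =
      \int[P]_t \sum_j (z 0 j - z0 0 j) * (G t 0 j - z0 0 j).
    rewrite Rintegral_sum//; apply: eq_bigr => j _.
    rewrite RintegralZl// RintegralB//; last exact: intcst.
    by rewrite Ecst expr2; congr (_ * (_ - _)); rewrite /z mxE.
  rewrite -[leRHS](Ecst 0).
  apply: le_Rintegral => //; last 2 first.
- exact: intcst.
- move=> t _; apply: nearest_point_le0 convC Cz0 _ _.
    by apply: GC; exists t.
  by move=> c Cc; exact: zmin (mem_set Cc).
- apply: (eq_integrable measurableT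
    (fun t => \sum_j ((z 0 j - z0 0 j) * (G t 0 j - z0 0 j))%:E)%E).
    by move=> t _; rewrite /= sumEFin.
  by apply: integrable_sum => // j _; exact: intM.
apply/rowP => j; apply/eqP; rewrite -subr_eq0 -sqrf_eq0 eq_le sqr_ge0 andbT.
apply: le_trans fz0; rewrite /f (bigD1 j)//= lerDl.
by apply: sumr_ge0 => k _; exact: sqr_ge0.
Qed.

(** * The value set as a slice of a convex hull *)

Lemma continuous_measurable_borel (R : realType) (X : finPointedType)
    (f : simplex R X -> R) :
  continuous f -> measurable_fun [set: simplex_borel R X] f.
Proof.
move=> /continuousP cf; apply: (measurability _ (RGenOpens.measurableE R)).
move=> _ [_ [a [b ->] <-]]; rewrite setTI; apply: sub_sigma_algebra.
exact/cf/interval_open.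
Qed.

Lemma continuous_integrable_simplex (R : realType) (X : finPointedType)
    (f : simplex R X -> R) (P : Delta2 R X) :
  continuous f -> P.-integrable setT (EFin \o f).
Proof.
move=> cf; apply: measurable_bounded_integrable => //.
- exact: le_lt_trans (probability_le1 _ _) (ltry _).
- exact: continuous_measurable_borel.
- have /compact_bounded[M [Mr bM]] : compact (range f).
    apply: continuous_compact; first exact: continuous_subspaceT.
    exact: compact_simplex.
  by exists M; split=> // N MN t _; apply: (bM N MN); exists t.
Qed.

Definition graph {R : realType} {X : finPointedType} {n : nat}
    (V : 'I_n -> simplex R X -> R) (nu : simplex R X) : 'rV[R]_(#|X| + n) :=
  row_mx (val nu) (\row_i V i nu).

Lemma continuous_simplex_coord (R : realType) (X : finPointedType) j :
  continuous (fun nu : simplex R X => val nu 0 j).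
Proof.
move=> nu; apply: (@continuous_comp _ _ _
  (val : simplex R X -> 'rV[R]_#|X|) (fun M : 'rV[R]_#|X| => M 0 j)).
  exact: continuous_simplex_val.
exact: coord_continuous.
Qed.

Lemma continuous_graph_coord (R : realType) (X : finPointedType) (n : nat)
    (V : 'I_n -> simplex R X -> R) j :
  (forall i, continuous (V i)) -> continuous (fun nu => graph V nu 0 j).
Proof.
move=> cV; rewrite /graph; case: (split_ordP j) => i ->.
  under eq_fun do rewrite row_mxEl; exact: continuous_simplex_coord.
by under eq_fun do rewrite row_mxEr mxE; exact: cV.
Qed.

Lemma continuous_graph (R : realType) (X : finPointedType) (n : nat)
    (V : 'I_n -> simplex R X -> R) :
  (forall i, continuous (V i)) -> continuous (graph V).
Proof.
move=> cV; apply: continuous_mx => i j; rewrite ord1.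
exact: continuous_graph_coord.
Qed.

Lemma closed_finite_simplex (R : realType) (X : finPointedType)
    (A : set (simplex R X)) :
  finite_set A -> closed A.
Proof.
move=> finA.
have -> : A = (val : simplex R X -> 'rV[R]_#|X|) @^-1` (val @` A).
  apply/seteqP; split=> nu; first by move=> Anu; exists nu.
  by move=> [nu' Anu' /val_inj <-].
apply: preimage_closed => [nu _|]; first exact: continuous_simplex_val.
apply: (iffLR accessible_finite_set_closed); last exact: finite_image.
exact/hausdorff_accessible/norm_hausdorff.
Qed.

Lemma finite_support_realization (R : realType) (X : finPointedType)
    (n N : nat) (V : 'I_n -> simplex R X -> R) (x : 'I_N -> simplex R X)
    (w : 'rV[R]_N) :
  (forall i, continuous (V i)) ->
  (forall i, 0 <= w 0 i) -> \sum_i w 0 i = 1 ->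
  exists P : Delta2 R X,
    row_mx (barycenter P) (expected_values V P) = w *m sample_mx (graph V) x /\
    measure_support P `<=` range x.
Proof.
move=> cV w0 w1; pose w' i := NngNum (w0 i).
have w1' : \sum_i (w' i)%:num = 1 by [].
pose P : Delta2 R X := @atomic _ (simplex_borel R X) R N w' x w1'.
exists P; split.
  rewrite mul_sample_mx; apply/rowP => j; rewrite summxE /graph.
  case: (split_ordP j) => i ->.
    rewrite row_mxEl mxE Rintegral_atomic.
      by apply: eq_bigr => k _; rewrite mxE row_mxEl.
    by apply: continuous_measurable_borel; exact: continuous_simplex_coord.
  rewrite row_mxEr mxE Rintegral_atomic.
    by apply: eq_bigr => k _; rewrite mxE row_mxEr mxE.
  exact: continuous_measurable_borel.
move=> nu supp; apply: contrapT => nux.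
(* the complement of the atoms is open and null *)
have oU : open (~` range x).
  by apply: closed_openC; apply: closed_finite_simplex; exact: finite_image.
have := supp _ (conj oU nux); rewrite [P _]atomicE big1 ?ltxx// => i _.
by rewrite diracE memNset ?mule0//; apply; exists i.
Qed.

(** The expectation of [graph V] is the pair formed by the barycenter and the
expected values, so both descriptions fix its first component to [mu]. *)
Lemma value_setP (R : realType) (X : finPointedType) (n : nat)
    (V : 'I_n -> simplex R X -> R) (mu : simplex R X) (v : 'rV[R]_n) :
  (forall i, continuous (V i)) ->
  value_set V mu v <-> mixtures (graph V) (row_mx (val mu) v).
Proof.
move=> cV; split=> [[P Pmu <-]|[N [x [w [w0 w1 E]]]]].
  have -> : row_mx (val mu) (expected_values V P) =
      \row_j \int[P]_nu graph V nu 0 j.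
    apply/rowP => j; rewrite -(Pmu : barycenter P = val mu) [RHS]mxE /graph.
    case: (split_ordP j) => i ->.
      by rewrite row_mxEl mxE; apply: eq_Rintegral => nu _; rewrite row_mxEl.
    by rewrite row_mxEr mxE; apply: eq_Rintegral => nu _; rewrite row_mxEr mxE.
  apply: expectation_in_compact_convex.
  - move=> j; apply: continuous_integrable_simplex.
    exact: continuous_graph_coord.
  - apply: compact_mixtures; first exact: compact_simplex.
    exact: continuous_graph.
  - exact: convex_mixtures.
  - by move=> _ [nu _ <-]; exact: mixtures_range.
have [P [PE _]] := finite_support_realization x cV w0 w1.
by exists P; move: PE; rewrite -E => /eq_row_mx[].
Qed.

(** * Faces and the size of the support *)

Lemma rank_le_dim (F : fieldType) (m n : nat) (M : 'M[F]_(m, n))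
    (U : {vspace 'rV[F]_n}) :
  (forall i, row i M \in U) -> (\rank M <= \dim U)%N.
Proof.
move=> MU; pose b := \matrix_(i < \dim U) (vbasis U)`_i.
apply: leq_trans (rank_leq_row b); apply: mxrankS; apply/row_subP => i.
rewrite (coord_vbasis (MU i)); apply: summx_sub => j _.
by rewrite scalemx_sub// (_ : (vbasis U)`_j = row j b) ?row_sub// rowK.
Qed.

(** The relations between the rows of [B] form a space of dimension at least
[N - m], on which multiplication by [C] is injective. *)
Lemma row_free_row_mx_leq (F : fieldType) (N m n : nat)
    (B : 'M[F]_(N, m)) (C : 'M[F]_(N, n)) :
  row_free (row_mx B C) -> (N <= m + \rank (kermx B *m C))%N.
Proof.
move=> free; have := mxrankMfree (kermx B) free.
rewrite mul_mx_row mulmx_ker rank_row_0mx => ->.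
by rewrite mxrank_ker -leq_subLR leq_sub2l// rank_leq_col.
Qed.

Lemma sum_mul_sample_simplex (R : realType) (X : finPointedType) (N : nat)
    (x : 'I_N -> simplex R X) (w : 'rV[R]_N) :
  \sum_j (w *m sample_mx val x) 0 j = \sum_i w 0 i.
Proof.
rewrite mul_sample_mx; under eq_bigr do rewrite summxE.
rewrite exchange_big/=; apply: eq_bigr => i _.
under eq_bigr do rewrite mxE.
have [_ x1] := set_mem (valP (x i)).
by rewrite -mulr_sumr x1 mulr1.
Qed.

Lemma exists_nonneg_step (R : realFieldType) (N : nat) (w c : 'rV[R]_N) :
  (forall i, 0 < w 0 i) ->
  exists2 t : R, 0 < t & forall s, `|s| = t -> forall i, 0 <= (w + s *: c) 0 i.
Proof.
move=> wp; pose a : R := \sum_j `|c 0 j| / w 0 j.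
have a0 : 0 <= a by apply: sumr_ge0 => j _; rewrite divr_ge0// ltW.
(* weight [i] allows steps up to [w_i / |c_i|], or any step if [c_i = 0]; the
   inverse of [1 + a] is within all these bounds *)
exists (1 + a)^-1 => [|s st i]; first by rewrite invr_gt0 ltr_wpDr.
have ca : `|s| * `|c 0 i| <= w 0 i.
  rewrite st mulrC ler_pdivrMr ?ltr_wpDr// -ler_pdivrMl//.
  rewrite [_^-1 * _]mulrC (@le_trans _ _ a)// ?lerDr// /a (bigD1 i)//= lerDl.
  by apply: sumr_ge0 => j _; rewrite divr_ge0// ltW.
rewrite !mxE; have := ler_norm (- (s * c 0 i)); rewrite normrN normrM; lra.
Qed.

(** [v] is the midpoint of the two points of [C], so the face [F] contains
these two points as well. *)
Lemma face_direction (R : realType) (n : nat) (C F : set 'rV[R]_n)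
    (U : {vspace 'rV[R]_n}) (p v d : 'rV[R]_n) (t : R) :
  is_face C F -> affine_hull F = [set p + u | u in [set` U]] ->
  F v -> 0 < t -> C (v + t *: d) -> C (v + (- t) *: d) -> d \in U.
Proof.
move=> [_ _ faceF] affF Fv t0 Cp Cm.
have [|| Fp _] := faceF _ _ 2^-1 Cp Cm; first by lra.
  rewrite (_ : 2^-1 *: _ + _ *: _ = v :> 'rV[R]_n)//.
  by apply/rowP => j; rewrite !mxE; field.
have inU y : F y -> exists2 u, u \in U & y = p + u.
  move=> Fy; have : affine_hull F y.
    by exists 1%N, (fun=> 1), (fun=> y); split; rewrite // big_ord1// scale1r.
  by rewrite affF => -[u Uu <-]; exists u.
have [u1 Uu1 E1] := inU _ Fv; have [u2 Uu2 E2] := inU _ Fp.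
have td : u2 - u1 = t *: d.
  move: E2; rewrite E1 -addrA => /addrI <-.
  by rewrite addrAC subrr add0r.
have -> : d = t^-1 *: (u2 - u1).
  by rewrite td scalerA mulVf ?scale1r// gt_eqF.
by rewrite memvZ// memvB.
Qed.

(** The points of the combination are chosen linearly independent; the
relations between their first components are then mapped injectively to the
directions of the face. *)
Lemma extreme_point_mixture (R : realType) (X : finPointedType) (n : nat)
    (V : 'I_n -> simplex R X -> R) (mu : simplex R X) (k : nat)
    (v : 'rV[R]_n) :
  (forall i, continuous (V i)) -> extreme_points k (value_set V mu) v ->
  exists N (x : 'I_N -> simplex R X) (w : 'rV[R]_N),
    [/\ (N <= #|X| + k)%N, forall i, 0 <= w 0 i, \sum_i w 0 i = 1 &
        row_mx (val mu) v = w *m sample_mx (graph V) x].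
Proof.
move=> cV [F [faceF [p [U [dimU affF]]] [Fv _]]].
have [FC _ _] := faceF.
have /FC/(value_setP _ _ cV)[N0 [x0 [w0 [w00 _ E0]]]] := Fv.
have [N [x [w [wp free E]]]] := conic_caratheodory (graph V) x0 w00.
rewrite -{}E0 in E.
set B : 'M[R]_(N, #|X|) := sample_mx val x.
set C : 'M[R]_(N, n) := sample_mx (fun nu => \row_i V i nu) x.
have graphE : sample_mx (graph V) x = row_mx B C by exact: sample_row_mx.
have [Emu Ev] : w *m B = val mu /\ w *m C = v.
  by move: E; rewrite graphE mul_mx_row => /eq_row_mx.
have [_ mu1] := set_mem (valP mu).
exists N, x, w; split=> // [|i|]; [|exact: ltW|]; last first.
  by rewrite -(sum_mul_sample_simplex x) -/B Emu.
apply: leq_trans (row_free_row_mx_leq (B := B) (C := C) _) _.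
  by rewrite -graphE.
rewrite leq_add2l -dimU; apply: rank_le_dim => i.
rewrite row_mul; have : row i (kermx B) *m B = 0.
  by rewrite -row_mul mulmx_ker row0.
move: (row i (kermx B)) => {i} c cB.
have [t t0 wt] := exists_nonneg_step c wp.
have step (s : R) : `|s| = t -> value_set V mu (v + s *: (c *m C)).
  have wcB : (w + s *: c) *m B = val mu.
    by rewrite mulmxDl -scalemxAl Emu cB scaler0 addr0.
  move=> st; apply/(value_setP _ _ cV); exists N, x, (w + s *: c); split.
  - exact: wt.
  - by rewrite -(sum_mul_sample_simplex x) -/B wcB.
  - by rewrite graphE mul_mx_row wcB mulmxDl -scalemxAl Ev.
apply: (face_direction faceF affF Fv t0); apply: step.
  by rewrite gtr0_norm.
by rewrite normrN gtr0_norm.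
Qed.

Unset Implicit Arguments.
Set Strict Implicit.

Theorem lemma1 (R : realType) (X : finPointedType) (n : nat)
    (V : 'I_n -> simplex R X -> R) (cV : forall i, continuous (V i))
    (mu : simplex R X) :
  [/\ compact (value_set V mu),
      convex_set (value_set V mu) &
      forall k : nat, (k <= n)%N ->
      forall v : 'rV[R]_n, extreme_points k (value_set V mu) v ->
      exists P : Delta2 R X,
        [/\ barycenter P = val mu,
            v = expected_values V P &
            (measure_support P #<= `I_((k + 1) * #|X|))%card]].
Proof.
have cG := continuous_graph cV.
have cM := compact_mixtures (@compact_simplex R X) cG.
split.
- have -> : value_set V mu =
      rsubmx @` (mixtures (graph V) `&` [set z | lsubmx z = val mu]).
    apply/seteqP; split=> v.
      move=> /(value_setP _ _ cV) Mv.
      exists (row_mx (val mu) v); last by rewrite row_mxKr.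
      by split; rewrite //= row_mxKl.
    move=> [z [Mz zmu] <-]; apply/(value_setP _ _ cV).
    by rewrite -(zmu : lsubmx z = val mu) hsubmxK.
  apply: continuous_compact.
    apply: continuous_subspaceT; apply: continuous_mx => i j.
    under eq_fun do rewrite mxE; exact: coord_continuous.
  apply: compact_closedI => //.
  apply: (@preimage_closed _ _
    (lsubmx : 'rV[R]_(#|X| + n) -> 'rV[R]_#|X|) [set val mu]) => [z _|].
    apply: continuous_mx => i j.
    under eq_fun do rewrite mxE; exact: coord_continuous.
  apply: accessible_closed_set1; exact/hausdorff_accessible/norm_hausdorff.
- move=> v1 v2 t /set_mem/(value_setP _ _ cV) M1.
  move=> /set_mem/(value_setP _ _ cV) M2.
  apply/mem_set/(value_setP _ _ cV).
  have := @convex_mixtures _ _ _ _ _ _ t (mem_set M1) (mem_set M2).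
  move/set_mem; congr mixtures.
  rewrite /conv/= !scale_row_mx add_row_mx -scalerDl unstable.add_onemK.
  by rewrite scale1r.
- move=> k kn v /(extreme_point_mixture cV)[N [x [w [Nk w0 w1 E]]]].
  have [P [PE suppP]] := finite_support_realization x cV w0 w1.
  exists P; move: PE; rewrite -E => /eq_row_mx[-> ->]; split=> //.
  apply: card_le_trans (subset_card_le suppP) _.
  apply: card_le_trans (card_image_le _ _) _.
  apply: (@card_le_trans _ _ _ `I_N).
    by have := @card_II N; rewrite card_eq_le => /andP[].
  rewrite card_le_II (leq_trans Nk)//.
  have : (0 < #|X|)%N by apply/card_gt0P; exists point.
  nia.
Qed.
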